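(* Let $X$ be a real Banach space, let $f\in\Gamma(X)$, and let $\bar x\in X$ and $\bar y^*\in X^*$ be such that $\bar y^*\in\partial f(\bar x)$. Then $\partial f$ is strongly subregular at $\bar x$ for $\bar y^*$ if and only if there exist a neighborhood $U$ of $\bar x$ and a positive constant $c$ such that $$f(x)\geq f(\bar x)+\langle \bar y^*,x-\bar x\rangle +c\|x-\bar x\|^2\quad\text{whenever } x\in U. \qquad ( * )$$ Specifically, if $\partial f$ is strongly subregular at $\bar x$ for $\bar y^*$ with constant $\kappa>0$, then for every $c<1/(4\kappa)$ the inequality $( * )$ holds (on some neighborhood $U$ of $\bar x$); conversely, if $( * )$ holds with constant $c>0$ (on some neighborhood $U$ of $\bar x$), then $\partial f$ is strongly subregular at $\bar x$ for $\bar y^*$ with constant $1/c$.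
   Context: $X^*$ is the dual of $X$. $\Gamma(X)$ is the set of all proper (i.e. with nonempty domain), lower semicontinuous, convex functions $f:X\to\mathbb{R}\cup\{\infty\}$; $\operatorname{dom} f=\{x: f(x)<\infty\}$. The subdifferential is the set-valued mapping $\partial f:X\rightrightarrows X^*$, $\partial f(x)=\{y^*\in X^*: f(z)\geq f(x)+\langle y^*,z-x\rangle \text{ for all } z\in X\}$ for $x\in\operatorname{dom} f$, and $\partial f(x)=\emptyset$ otherwise. The distance is $d(x,C)=\inf_{y\in C}\|x-y\|$, with $d(x,\emptyset)=\infty$. A set-valued mapping $F:X\rightrightarrows Y$ between Banach spaces is strongly (metrically) subregular at $\bar x$ for $\bar y$ (with constant $\kappa$) if $\bar y\in F(\bar x)$ and there are $\kappa>0$ and neighborhoods $U$ of $\bar x$ and $V$ of $\bar y$ such that $\|x-\bar x\|\leq\kappa\, d(\bar y,F(x)\cap V)$ for all $x\in U$. *)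

(* Defs.v *)
From HB Require Import structures.
From mathcomp Require Import all_boot all_order all_algebra.
From mathcomp Require Import all_classical all_reals.
From mathcomp Require Import ereal topology normedtype.

Set Implicit Arguments.
Unset Strict Implicit.
Unset Printing Implicit Defensive.

Import Order.TTheory GRing.Theory Num.Theory.
Import numFieldNormedType.Exports.

Local Open Scope classical_set_scope.
Local Open Scope ring_scope.

Section topological_dual.
Context {R : realType} (X : normedModType R).

Definition topdual_pred : {pred X -> R^o} :=
  mem [set f : X -> R^o | linear f /\ continuous f].

Record topdual := TopDual {
  topdual_fun :> X -> R^o ;
  _ : topdual_fun \in topdual_pred }.

HB.instance Definition _ := [isSub for topdual_fun].
HB.instance Definition _ := [Choice of topdual by <:].

Lemma topdual_submod_closed : submod_closed topdual_pred.
Proof.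
split.
  rewrite inE; split; last exact: (@cst_continuous X R^o 0).
  by move=> a x y; rewrite -[0]/(cst 0) /cst scaler0 addr0.
move=> a f g; rewrite !inE => -[lf cf] [lg cg]; split.
  move=> k x y.
  change (a *: f (k *: x + y) + g (k *: x + y) =
    k *: (a *: f x + g x) + (a *: f y + g y)).
  by rewrite lf lg !scalerDr !scalerA [a * k]mulrC addrACA.
move=> x; apply: (@continuousD _ R^o); last exact: cg.
by apply: (@continuousZl_tmp _ R^o) => //; exact: cf.
Qed.

HB.instance Definition _ :=
  GRing.isSubmodClosed.Build R (X -> R^o) topdual_pred topdual_submod_closed.
HB.instance Definition _ := [SubChoice_isSubLmodule of topdual by <:].

Lemma topdualP (y : topdual) : linear y /\ continuous y.
Proof. by have := valP y; rewrite inE. Qed.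

HB.instance Definition _ (y : topdual) :=
  GRing.isLinear.Build R X R^o *:%R y (proj1 (topdualP y)).

Lemma topdual_continuous (y : topdual) : continuous y.
Proof. by case: (topdualP y). Qed.

Definition topdual_norm (y : topdual) : R :=
  sup [set `|y x| | x in [set x : X | `|x| <= 1]].

Lemma topdual_has_sup (y : topdual) :
  has_sup [set `|y x| | x in [set x : X | `|x| <= 1]].
Proof.
split; first by exists `|y 0|; exists 0 => //=; rewrite normr0.
have /bounded_funP/(_ 1)[M yM] :=
  @continuous_linear_bounded _ _ _ 0 y (@topdual_continuous y 0).
by exists M => _ [x /= x1 <-]; exact: yM.
Qed.

Lemma topdual_norm_ub (y : topdual) (x : X) : `|x| <= 1 ->
  `|y x| <= topdual_norm y.
Proof.
move=> x1; apply: (sup_upper_bound (topdual_has_sup y)).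
by exists x.
Qed.

Lemma topdual_norm_le (y : topdual) (M : R) :
  (forall x : X, `|x| <= 1 -> `|y x| <= M) -> topdual_norm y <= M.
Proof.
move=> yM; apply: ge_sup; first by case: (topdual_has_sup y).
by move=> _ [x /= x1 <-]; exact: yM.
Qed.

Lemma topdual_norm_ge0 (y : topdual) : 0 <= topdual_norm y.
Proof.
by apply: le_trans (topdual_norm_ub y (x := 0) _); rewrite ?normr0.
Qed.

Lemma topdual_norm_bound (y : topdual) (x : X) :
  `|y x| <= topdual_norm y * `|x|.
Proof.
have [->|x0] := eqVneq x 0; first by rewrite linear0 !normr0 mulr0.
have nx0 : 0 < `|x| by rewrite normr_gt0.
rewrite -ler_pdivrMr// mulrC -[X in X * _](@ger0_norm _ `|x|^-1)//.
rewrite -normrM.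
have -> : `|x|^-1 * y x = y (`|x|^-1 *: x) by rewrite linearZ.
apply: topdual_norm_ub.
by rewrite normrZ normfV normr_id mulVf// gt_eqF.
Qed.

Lemma topdual_ler_normD (y z : topdual) :
  topdual_norm (y + z) <= topdual_norm y + topdual_norm z.
Proof.
apply: topdual_norm_le => x x1; apply: le_trans (ler_normD (y x) (z x)) _.
by rewrite lerD// topdual_norm_ub.
Qed.

Lemma topdual_normrZ (a : R) (y : topdual) :
  topdual_norm (a *: y) = `|a| * topdual_norm y.
Proof.
have le_normZ b z : topdual_norm (b *: z) <= `|b| * topdual_norm z.
  apply: topdual_norm_le => x x1.
  have -> : (b *: z) x = b * z x by [].
  by rewrite normrM ler_wpM2l// topdual_norm_ub.
apply/eqP; rewrite eq_le le_normZ /=.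
have [->|a0] := eqVneq a 0; first by rewrite normr0 mul0r topdual_norm_ge0.
rewrite mulrC -ler_pdivlMr ?normr_gt0// mulrC -normfV.
by rewrite -[in leLHS](scalerK a0 y) le_normZ.
Qed.

Lemma topdual_normr0_eq0 (y : topdual) : topdual_norm y = 0 -> y = 0.
Proof.
move=> y0; apply/val_inj/funext => x; apply/normr0_eq0/eqP.
by rewrite eq_le normr_ge0 andbT (le_trans (topdual_norm_bound y x))// y0 mul0r.
Qed.

HB.instance Definition _ := Lmodule_isNormed.Build R topdual
  topdual_ler_normD topdual_normrZ topdual_normr0_eq0.

Lemma topdual_normE (y : topdual) :
  `|y| = sup [set `|y x| | x in [set x : X | `|x| <= 1]].
Proof. by []. Qed.

End topological_dual.

Section convex_analysis.
Context {R : realType} {X : normedModType R}.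
Local Open Scope ereal_scope.

Definition edom (f : X -> \bar R) : set X := [set x | f x < +oo].

(* No indeterminate sum occurs: -oo is excluded as a value of f in Gamma, and
   0 * +oo = 0 makes the inequality trivial for t = 0 and t = 1. *)
Definition econvex (f : X -> \bar R) : Prop :=
  forall (x y : X) (t : R), (0 <= t <= 1)%R ->
    f (t *: x + (1 - t) *: y)%R <= t%:E * f x + (1 - t)%:E * f y.

Definition Gamma (f : X -> \bar R) : Prop :=
  [/\ forall x, f x != -oo,
      edom f !=set0,
      lower_semicontinuous f
    & econvex f].

Definition subdifferential (f : X -> \bar R) (x : X) : set (topdual X) :=
  [set y | edom f x /\ forall z, f x + (y (z - x)%R)%:E <= f z].

Definition quadratic_growth (f : X -> \bar R) (xb : X) (yb : topdual X)
    (c : R) : Prop :=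
  exists2 U, nbhs xb U &
    forall x, U x ->
      f xb + (yb (x - xb)%R)%:E + (c * `|x - xb| ^+ 2)%:E <= f x.

End convex_analysis.

Section strong_subregularity.
Context {R : realType} {X Y : normedModType R}.
Local Open Scope ereal_scope.

(* +oo when C is empty *)
Definition dist (y : Y) (C : set Y) : \bar R :=
  ereal_inf [set `|y - z|%:E | z in C].

Definition strongly_subregular_with (F : X -> set Y) (xb : X) (yb : Y)
    (kappa : R) : Prop :=
  [/\ F xb yb, (0 < kappa)%R &
      exists U V, [/\ nbhs xb U, nbhs yb V &
        forall x, U x -> `|x - xb|%:E <= kappa%:E * dist yb (F x `&` V)]].

Definition strongly_subregular (F : X -> set Y) (xb : X) (yb : Y) : Prop :=
  exists kappa, strongly_subregular_with F xb yb kappa.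

End strong_subregularity.

(* Main.v *)
(* If quadratic growth with constant c fails at some x near xb, put
   r = |x - xb| > 0. The tilted function g = f - f xb - <yb, _ - xb> is
   nonnegative with g x < c r^2, so Ekeland's principle with slope 2 c r gives u
   with |u - x| < r / 2 minimizing g + 2 c r |_ - u|. Hahn-Banach turns this into
   xi in the subdifferential of g at u with |xi| <= 2 c r, and subregularity gives
   r / 2 < |u - xb| <= 2 kappa c r, i.e. c > 1 / (4 kappa). Conversely, adding the
   growth inequality to the subgradient inequality of y at x yields
   c |x - xb|^2 <= <y - yb, x - xb>, hence c |x - xb| <= |yb - y|. *)
Require Import Defs.
From mathcomp Require Import all_boot all_order all_algebra.
From mathcomp Require Import all_classical all_reals.
From mathcomp Require Import ereal topology normedtype.
From mathcomp Require Import lra.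
From HB Require Import structures.
Import Order.TTheory GRing.Theory Num.Theory.
Import numFieldNormedType.Exports.
Local Open Scope ring_scope.

Set Implicit Arguments.
Unset Strict Implicit.
Unset Printing Implicit Defensive.

(** * Hahn-Banach theorem: a linear minorant of a sublinear functional *)

Section hahn_banach.
Context {R : realType} {V : lmodType R}.
Implicit Types p q : V -> R.
Local Open Scope classical_set_scope.

(** Homogeneity is only an inequality for positive scalars, the form that passes to infima; the
    inverse scalar turns it into an equality. *)
Definition sublinear p :=
  (forall x y, p (x + y) <= p x + p y) /\
  (forall (s : R) x, 0 < s -> p (s *: x) <= s * p x).

Lemma sublinear0 p : sublinear p -> p 0 = 0.
Proof.
move=> [pD pZ]; have := pD 0 0; have := pZ 2^-1 0.
by rewrite addr0 scaler0 => /(_ ltac:(lra)); lra.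
Qed.

Lemma sublinear_oppr p x : sublinear p -> 0 <= p x + p (- x).
Proof. by move=> sp; have [pD _] := sp; rewrite -(sublinear0 sp) -(subrr x). Qed.

Lemma sublinear_pscale p s x : sublinear p -> 0 < s -> p (s *: x) = s * p x.
Proof.
move=> [_ pZ] s0; apply/eqP; rewrite eq_le pZ//=.
have := pZ s^-1 (s *: x); rewrite invr_gt0 scalerA mulVf ?gt_eqF// scale1r.
by move=> /(_ s0); rewrite mulrC ler_pdivlMr// mulrC.
Qed.

Section infimum.
Context {I : Type} (D : set I) (F : I -> V -> R).
Hypothesis D0 : D !=set0.
Hypothesis Flb : forall x, exists m, forall i, D i -> m <= F i x.

Let has_lboundF x : has_lbound [set F i x | i in D].
Proof. by have [m mF] := Flb x; exists m => _ [i Di <-]; exact: mF. Qed.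

Lemma le_inf_family i x : D i -> inf [set F i x | i in D] <= F i x.
Proof. by move=> Di; apply: ge_inf => //; exists i. Qed.

Lemma inf_family_ge m x : (forall i, D i -> m <= F i x) ->
  m <= inf [set F i x | i in D].
Proof.
move=> mF; apply: lb_le_inf; first by have [i Di] := D0; exists (F i x), i.
by move=> _ [i Di <-]; exact: mF.
Qed.

(** The members need not be sublinear: it is enough that [F i x + F j y] dominates some member at
    [x + y], and likewise for scaling. This covers chains as well as infima of convolution type. *)
Lemma sublinear_inf :
  (forall i j x y, D i -> D j ->
    exists2 k, D k & F k (x + y) <= F i x + F j y) ->
  (forall i (s : R) x, D i -> 0 < s ->
    exists2 k, D k & F k (s *: x) <= s * F i x) ->
  sublinear (fun x => inf [set F i x | i in D]).
Proof.
move=> FD FZ; split=> [x y|s x s0].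
  rewrite -lerBlDl; apply: inf_family_ge => j Dj.
  rewrite lerBlDl -lerBlDr; apply: inf_family_ge => i Di.
  rewrite lerBlDr; have [k Dk] := FD i j x y Di Dj.
  exact/le_trans/le_inf_family.
rewrite mulrC -ler_pdivrMr//; apply: inf_family_ge => i Di.
rewrite ler_pdivrMr// mulrC; have [k Dk] := FZ i s x Di s0.
exact/le_trans/le_inf_family.
Qed.

End infimum.

(** Zorn's lemma for the reversed pointwise order. The infimum of a chain is sublinear because any
    two members are comparable, and finite because [t x >= - t (- x) >= - q (- x)] for each member
    [t]. *)
Lemma minimal_sublinear q : sublinear q -> exists p, [/\ sublinear p,
  forall x, p x <= q x &
  forall p', sublinear p' -> (forall x, p' x <= p x) -> forall x, p x <= p' x].
Proof.
move=> sq; pose T := {p | sublinear p /\ forall x, p x <= q x}.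
have qT : sublinear q /\ forall x, q x <= q x by [].
pose r (s t : T) := `[< forall x, sval t x <= sval s x >].
have [| | |[p [sp pq]] pmin] := @ZL_preorder T (exist _ q qT) r.
- by move=> s; apply/asboolP.
- move=> s t u /asboolP st /asboolP tu; apply/asboolP => x.
  exact: le_trans (tu x) (st x).
- move=> A Atot; have [->|/set0P A0] := eqVneq A set0.
    by exists (exist _ q qT) => s [].
  have Alb x : exists m, forall t : T, A t -> m <= sval t x.
    exists (- q (- x)) => -[t [st tq]] _ /=.
    have := sublinear_oppr x st; have := tq (- x); lra.
  pose p x := inf [set sval t x | t in A].
  have sp : sublinear p.
    apply: sublinear_inf => //.
    + move=> s t x y As At; have [/asboolP st|/asboolP ts] := Atot s t As At.
        exists t => //; have [[tD _] _] := svalP t.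
        by apply: le_trans (tD _ _) _; rewrite lerD2r.
      exists s => //; have [[sD _] _] := svalP s.
      by apply: le_trans (sD _ _) _; rewrite lerD2l.
    + by move=> t s x At s0; exists t => //; have [[_ tZ] _] := svalP t; exact: tZ.
  have pq x : p x <= q x.
    have [t At] := A0; have [_ tq] := svalP t.
    exact: le_trans (le_inf_family Alb x At) (tq x).
  exists (exist _ p (conj sp pq)) => t At; apply/asboolP => x /=.
  exact: (le_inf_family Alb x At).
exists p; split=> // p' sp' p'p.
have p'q x : p' x <= q x := le_trans (p'p x) (pq x).
by have /asboolP := pmin (exist _ p' (conj sp' p'q)) ltac:(exact/asboolP).
Qed.

(* For minimal p, the sublinear functional x |-> inf_{t >= 0} p (x + t a) - t p a
   lies below p, hence equals p; taking t = 1 at x = - a makes p odd. *)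
Lemma minimal_sublinear_odd p a : sublinear p ->
  (forall p', sublinear p' -> (forall x, p' x <= p x) ->
    forall x, p x <= p' x) ->
  p (- a) = - p a.
Proof.
move=> sp pmin; have [pD pZ] := sp.
pose F (t : R) x := p (x + t *: a) - t * p a.
have pZ0 t x : 0 <= t -> p (t *: x) = t * p x.
  rewrite le_eqVlt => /predU1P[<-|t0]; first by rewrite scale0r mul0r sublinear0.
  exact: sublinear_pscale.
have D0 : [set t : R | 0 <= t] !=set0 by exists 0 => /=.
(* Subadditivity gives [t * p a <= p (x + t *: a) + p (- x)]. *)
have Flb x : exists m, forall t, 0 <= t -> m <= F t x.
  exists (- p (- x)) => t t0; have := pD (x + t *: a) (- x).
  rewrite addrC addKr pZ0// /F; lra.
pose p' x := inf [set F t x | t in [set t : R | 0 <= t]].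
have sp' : sublinear p'.
  apply: sublinear_inf => //.
    move=> s t x y /= s0 t0; exists (s + t); first exact: addr_ge0.
    have := pD (x + s *: a) (y + t *: a).
    rewrite /F scalerDl addrACA; lra.
  move=> t s x /= t0 s0; exists (s * t); first by rewrite mulr_ge0// ltW.
  by rewrite /F mulrBr mulrA -scalerA -scalerDr lerD2r pZ.
have p'p x : p' x <= p x.
  have := le_inf_family Flb x (lexx (0 : R)).
  by rewrite /F scale0r addr0 mul0r subr0.
have := pmin p' sp' p'p (- a).
have := le_inf_family Flb (- a) (@ler01 R : [set t | 0 <= t] 1).
rewrite -/(p' (- a)) /F scale1r addNr mul1r sublinear0//.
have := sublinear_oppr a sp; lra.
Qed.

(** A minimal sublinear functional below [q] is linear: oddness turns subadditivity at [- u] and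
    [- v] into superadditivity, and extends homogeneity to negative scalars. *)
Lemma hahn_banach q : sublinear q ->
  exists2 l : V -> R^o, linear l & forall x, l x <= q x.
Proof.
move=> sq; have [p [sp pq pmin]] := minimal_sublinear sq.
have pN x := minimal_sublinear_odd x sp pmin.
exists p => // s x y; have [pD _] := sp.
have pDE u v : p (u + v) = p u + p v.
  by have := pD u v; have := pD (- u) (- v); rewrite -opprD !pN; lra.
rewrite pDE; congr (_ + _).
have [s0|s0|->] := ltgtP s 0; last by rewrite !scale0r sublinear0.
  apply: oppr_inj; rewrite -pN -scaleNr sublinear_pscale ?oppr_gt0//.
  by rewrite mulNr.
exact: sublinear_pscale.
Qed.

End hahn_banach.

(** * Subgradients at a minimizer of a convex function plus a multiple of the norm *)

Section subdifferential_sum.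
Context {R : realType} {X : normedModType R}.
Local Open Scope classical_set_scope.

(** The one-sided bound at [- x] supplies the bound on the absolute value, hence continuity. *)
Lemma linear_bounded_topdual (l : X -> R^o) (M : R) : 0 <= M -> linear l ->
  (forall x, l x <= M * `|x|) ->
  exists2 xi : topdual X, `|xi| <= M & forall x, xi x = l x.
Proof.
move=> M0 ll lM.
pose lH := GRing.isLinear.Build R X R^o *:%R l ll.
pose L : {linear X -> R^o} := HB.pack l lH.
have LM x : `|L x| <= M * `|x|.
  rewrite ler_norml (lM x) andbT lerNl -linearN -(normrN x).
  exact: lM.
have cl : continuous l.
  apply: (@bounded_linear_continuous _ _ _ L); apply/linear_boundedP.
  exists M; split; first exact: num_real.
  by move=> r Mr x; apply: le_trans (LM x) _; rewrite ler_wpM2r// ltW.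
have lP : l \in @topdual_pred R X by rewrite inE.
exists (TopDual lP) => //.
apply: topdual_norm_le => x x1; apply: le_trans (LM x) _.
by rewrite ler_piMr.
Qed.

Lemma econvex_fin_le (f : X -> \bar R) (x y : X) (a b t : R) : econvex f ->
  f x = a%:E -> f y = b%:E -> 0 <= t <= 1 ->
  (f (t *: x + (1 - t) *: y)%R <= (t * a + (1 - t) * b)%:E)%E.
Proof. by move=> cf fx fy t01; have := cf x y t t01; rewrite fx fy. Qed.

(* A linear minorant of q (x) = inf { s (f (u + v) - f u) + eta |x - s v| },
   s > 0 and v ranging over X, is both below f (u + _) - f u (s = 1, x = v)
   and below eta |_| (v = 0). *)
Lemma subdifferential_perturbed_min (f : X -> \bar R) (u : X) (eta : R) :
  (forall x, f x != -oo%E) -> econvex f -> f u \is a fin_num -> 0 <= eta ->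
  (forall x, f u <= f x + (eta * `|x - u|)%:E)%E ->
  exists2 xi : topdual X, `|xi| <= eta & subdifferential f u xi.
Proof.
move=> fNoo cf fu eta0 umin.
pose phi v := fine (f (u + v)) - fine (f u).
(* As [fine] sends [+oo] to 0, [phi v] is meaningful only where [f (u + v)] is finite; [D] restricts
   the infimum to such [v]. *)
pose D := [set i : R * X | 0 < i.1 /\ (f (u + i.2)%R < +oo)%E].
pose F (i : R * X) x := i.1 * phi i.2 + eta * `|x - i.1 *: i.2|.
have fE v : (f (u + v)%R < +oo)%E -> f (u + v) = (phi v + fine (f u))%:E.
  by move=> fv; rewrite subrK fineK// fin_numE fNoo lt_eqF.
have phi0 : phi 0 = 0 by rewrite /phi addr0 subrr.
have phi_lb v : (f (u + v)%R < +oo)%E -> - (eta * `|v|) <= phi v.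
  move=> /fE fv; have := umin (u + v).
  by rewrite fv -[f u]fineK// -EFinD lee_fin [u + v]addrC addrK; lra.
have D1 : D (1, 0) by split=> //=; rewrite addr0 ltey_eq fu.
have D0 : D !=set0 by exists (1, 0).
(* Minimality at [u] gives [s * phi v >= - eta * |s v|], and [|s v| <= |x - s v| + |x|]. *)
have Flb x : exists m, forall i, D i -> m <= F i x.
  exists (- (eta * `|x|)) => -[s v] [/= s0 /phi_lb hv].
  have : - (s * (eta * `|v|)) <= s * phi v by rewrite -mulrN ler_wpM2l// ltW.
  have : eta * `|s *: v| <= eta * `|x - s *: v| + eta * `|x|.
    by rewrite -mulrDr ler_wpM2l// -[leLHS]normrN -{1}(addrK x (- _))
      [X in X - x]addrC ler_normB.
  by rewrite normrZ gtr0_norm// /F /= mulrCA; lra.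
have Fsub : sublinear (fun x => inf [set F i x | i in D]).
  apply: sublinear_inf => //.
  - move=> [s v] [t w] x y [/= s0 fv] [/= t0 fw].
    have st0 : 0 < s + t by exact: addr_gt0.
    (* With weight [a = s / (s + t)], the convex combination [z] of [v] and [w] satisfies
       [(s + t) z = s v + t w], so convexity of [f] bounds [(s + t) * phi z]. *)
    have [a a01 sa] : exists2 a : R, 0 <= a <= 1 & (s + t) * a = s.
      exists (s / (s + t)); last by rewrite mulrC divfK// gt_eqF.
      by rewrite divr_ge0 ?(ltW s0) ?(ltW st0)// ler_pdivrMr// mul1r; lra.
    pose z := a *: v + (1 - a) *: w.
    have stz : (s + t) *: z = s *: v + t *: w.
      by rewrite scalerDr !scalerA mulrBr mulr1 sa addrAC subrr add0r.
    have uz : u + z = a *: (u + v) + (1 - a) *: (u + w).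
      by rewrite !scalerDr addrACA -scalerDl addrC [a + _]addrC subrK scale1r addrC.
    have fz := econvex_fin_le cf (fE v fv) (fE w fw) a01.
    rewrite -uz in fz.
    have fzoo : (f (u + z)%R < +oo)%E by exact: le_lt_trans fz (ltry _).
    exists (s + t, z) => //; rewrite /F /= stz.
    have : (s + t) * phi z <= s * phi v + t * phi w.
      move: fz; rewrite fE// lee_fin => fz.
      have : phi z <= a * phi v + (1 - a) * phi w by lra.
      move: (phi z) (phi v) (phi w) => A B C /(ler_wpM2l (ltW st0)).
      by rewrite mulrDr !mulrA mulrBr mulr1 sa; lra.
    have : `|x + y - (s *: v + t *: w)| <= `|x - s *: v| + `|y - t *: w|.
      by rewrite opprD addrACA ler_normD.
    by move=> /(ler_wpM2l eta0); lra.
  - move=> [s v] t x [/= s0 fv] t0; exists (t * s, v).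
      by split => //=; exact: mulr_gt0.
    rewrite /F /= -scalerA -scalerBr normrZ gtr0_norm//; lra.
have [l ll lq] := hahn_banach Fsub.
have lF i x : D i -> l x <= F i x.
  by move=> Di; exact/(le_trans (lq x))/(le_inf_family Flb).
have [xi xi_eta xiE] : exists2 xi : topdual X, `|xi| <= eta &
    forall x, xi x = l x.
  apply: linear_bounded_topdual => // x; have := lF _ x D1.
  by rewrite /F /= phi0 mulr0 add0r scaler0 subr0.
exists xi => //; split; first by rewrite /edom /= ltey_eq fu.
move=> z; have [fz|] := ltP (f z) +oo%E; last first.
  by rewrite leye_eq => /eqP ->; rewrite leey.
have zE : z = u + (z - u) by rewrite addrC subrK.
rewrite {2}zE fE -?zE// -[f u]fineK// -EFinD lee_fin addrC lerD2r xiE.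
have := lF (1, z - u) (z - u).
rewrite /F /= scale1r subrr normr0 mulr0 addr0 mul1r; apply.
by split=> //=; rewrite -zE.
Qed.

End subdifferential_sum.

(** * Ekeland's variational principle *)

Section ekeland.
Context {R : realType} {X : completeNormedModType R}.
Local Open Scope classical_set_scope.

(** Testing lower semicontinuity at level [a + e] leaves a margin [e] to absorb a continuous
    perturbation. *)
Lemma lte_EFin_gap (a : R) (y : \bar R) : (a%:E < y)%E ->
  exists2 e, 0 < e & ((a + e)%:E < y)%E.
Proof.
case: y => [b| |]//; rewrite ?lte_fin => ab; last by exists 1; rewrite ?ltry.
by exists ((b - a) / 2); rewrite ?lte_fin; lra.
Qed.

(* Zorn's lemma for the preorder x <= y iff f y + eta |x - y| <= f x: f is
   monotone and bounded on a chain, which is therefore Cauchy, and lower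
   semicontinuity makes its limit an upper bound. *)
Lemma ekeland (f : X -> \bar R) (z : X) (eta : R) :
  lower_semicontinuous f -> (forall x, 0 <= f x)%E -> f z \is a fin_num ->
  0 < eta ->
  exists2 u, (f u + (eta * `|z - u|)%:E <= f z)%E &
    forall x, (f u <= f x + (eta * `|x - u|)%:E)%E.
Proof.
move=> lf f0 fz eta0.
pose le x y := (f y + (eta * `|x - y|)%:E <= f x)%E.
have le_refl x : le x x by rewrite /le subrr normr0 mulr0 adde0.
have leXt y x t : le x y -> le y t -> le x t.
  move=> xy yt; apply: le_trans xy; apply: le_trans (leeD2r _ yt).
  by rewrite -addeA leeD2l// -EFinD lee_fin -mulrDr ler_pM2l// [leRHS]addrC ler_distD.
(* Keeping only points above [z] makes [f] finite on [T] and yields the first conclusion. *)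
pose T := {x | le z x}; pose r (s t : T) := le (sval s) (sval t).
have fT (t : T) : f (sval t) = (fine (f (sval t)))%:E.
  rewrite fineK// fin_numElt (lt_le_trans _ (f0 _))//=.
  apply: le_lt_trans _ (_ : f z < +oo)%E.
    by apply: le_trans (svalP t); rewrite leeDl// lee_fin mulr_ge0// ltW.
  by rewrite ltey_eq fz.
have [| | |[u zu] umax] := @ZL_preorder T (exist _ z (le_refl z)) r.
- by move=> t; exact: le_refl.
- by move=> s t w; exact: leXt.
- move=> A Atot; have [->|/set0P A0] := eqVneq A set0.
    by exists (exist _ z (le_refl z)).
  (* The sets [B s] are the tails of the chain; the filter [G] they generate plays the role of a
     sequence. *)
  pose B (s : T) := [set x | exists t, [/\ A t, r s t & sval t = x]].
  pose G := filter_from A B.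
  have FG : ProperFilter G.
    apply: filter_from_proper => [|s As]; last first.
      by exists (sval s), s; split=> //; exact: le_refl.
    apply: filter_from_filter => // s t As At.
    have Bsub s' t' : r s' t' -> B t' `<=` B s'.
      by move=> st _ [w [Aw tw <-]]; exists w; split=> //; exact: leXt st tw.
    have [st|ts] := Atot s t As At.
      by exists t => // x Btx; split=> //; exact: Bsub st _ Btx.
    by exists s => // x Bsx; split=> //; exact: Bsub ts _ Bsx.
  have cG : cvg G.
    apply: cauchy_cvg; apply: cauchy_exP => e e0.
    have infA : has_inf [set fine (f (sval t)) | t in A].
      split; first by have [t At] := A0; exists (fine (f (sval t))), t.
      by exists 0 => _ [t At <-]; rewrite fine_ge0.
    (* A value within [eta * e] of the infimum confines the tail:
       [eta * |s - t| <= f s - f t < eta * e]. *)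
    have [_ [s As <-] sinf] := inf_adherent (mulr_gt0 eta0 e0) infA.
    exists (sval s), s => // _ [t [At st <-]].
    rewrite -ball_normE /ball_ /= -(ltr_pM2l eta0).
    have : inf [set fine (f (sval t)) | t in A] <= fine (f (sval t)).
      by apply: ge_inf; [exact: infA.2|exists t].
    move: st; rewrite /r /le (fT s) (fT t) -EFinD lee_fin; lra.
  have limA s : A s -> le (sval s) (lim G).
    move=> As; rewrite /le leNgt; apply/negP.
    rewrite fT -lteBlDr// -EFinB => /lte_EFin_gap[e e0] /lf[U GU fU].
    (* Within this radius [eta * |t - lim G| < e], so a later chain member [t] near the limit
       contradicts [f t + eta * |s - t| <= f s]. *)
    have e'0 : 0 < e / eta by exact: divr_gt0.
    have Gs : G (B s) by exists s.
    have GV : G (U `&` ball (lim G) (e / eta)).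
      by apply: cG; apply: filterI => //; exact: nbhsx_ballx.
    have [y [[Uy Gy] [t [At st ty]]]] := filter_ex (filterI GV Gs).
    move: Gy (fU y Uy) st; rewrite /r /le -ball_normE /ball_ /= -ty.
    rewrite (fT s) (fT t) -EFinD lte_fin lee_fin.
    rewrite -(ltr_pM2l eta0) mulrCA divff ?gt_eqF// mulr1.
    have := ler_wpM2l (ltW eta0) (ler_distD (sval t) (sval s) (lim G)).
    by rewrite mulrDr [`|sval t - _|]distrC; lra.
  have [s As] := A0.
  exists (exist _ (lim G) (leXt _ _ _ (svalP s) (limA s As))) => t At.
  exact: limA.
(* A violation at [x] puts [x] above [u]; maximality then puts [u] above [x], so [f u <= f x], a
   contradiction. *)
exists u => // x; rewrite leNgt; apply/negP => ux.
have lux : le u x by rewrite /le distrC ltW.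
have := umax (exist _ x (leXt _ _ _ zu lux)) lux.
rewrite /r /le /= => xu; move: ux; rewrite ltNge => /negP; apply.
have nneg (w : R) : 0 <= w -> (0 <= (eta * w)%:E)%E.
  by move=> w0; rewrite lee_fin mulr_ge0// ltW.
apply: le_trans (leeDl _ (nneg _ (normr_ge0 (x - u)))).
by apply: le_trans xu; rewrite leeDl// nneg.
Qed.
End ekeland.

(** * Subtracting an affine function *)

Section affine_perturbation.
Context {R : realType} {X : normedModType R}.
Implicit Types (f : X -> \bar R) (l : X -> R) (y : topdual X).
Local Open Scope ereal_scope.

Lemma lower_semicontinuousB f l : lower_semicontinuous f -> continuous l ->
  lower_semicontinuous (fun x => f x - (l x)%:E).
Proof.
move=> lf cl x a /=; rewrite EFinN lteBrDr// -EFinD => /lte_EFin_gap[e e0] /lf[U xU fU].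
exists (U `&` [set z | `|l x - l z| < e]%R)%classic.
  apply: filterI => //; move/cvgrPdist_lt: (cl x) => /(_ e e0); exact.
move=> z [/fU fz /= lz] /=; rewrite EFinN lteBrDr//; apply: le_lt_trans fz.
by rewrite -EFinD lee_fin; move: lz; rewrite ltr_norml => /andP[]; lra.
Qed.

Lemma econvexB f l : econvex f ->
  (forall (x z : X) (t : R),
    l (t *: x + (1 - t) *: z) = t * l x + (1 - t) * l z)%R ->
  econvex (fun x => f x - (l x)%:E).
Proof.
move=> cf al x z t t01; rewrite !muleBr ?fin_num_adde_defl//.
by rewrite addeACA -oppeD// -!EFinM -EFinD al leeB// cf.
Qed.

(** [fine] keeps the subtracted term real, so no indeterminate difference arises. *)
Definition tilt f y (x0 : X) (x : X) := f x - (fine (f x0) + y (x - x0)%R)%:E.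

Lemma tilt_lower_semicontinuous f y x0 :
  lower_semicontinuous f -> lower_semicontinuous (tilt f y x0).
Proof.
move=> lf; apply: lower_semicontinuousB => // x; apply: cvgD; first exact: cvg_cst.
apply: (@continuous_comp _ _ R^o (fun x => x - x0)%R y x).
  by apply: cvgB; [exact: cvg_id|exact: cvg_cst].
exact: topdual_continuous.
Qed.

Lemma tilt_econvex f y x0 : econvex f -> econvex (tilt f y x0).
Proof.
move=> cf; apply: econvexB => // x z t.
have -> : (t *: x + (1 - t) *: z - x0 = t *: (x - x0) + (1 - t) *: (z - x0))%R.
  rewrite !scalerBr addrACA -opprD -scalerDl [(t + _)%R]addrC subrK.
  by rewrite scale1r.
rewrite linearD !linearZ /= /GRing.scale /=; lra.
Qed.

(** Restoring the affine part shifts subgradients by its slope [y]. *)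
Lemma subdifferential_tilt f y x0 u (xi : topdual X) :
  (forall x, f x != -oo) ->
  subdifferential (tilt f y x0) u xi -> subdifferential f u (y + xi)%R.
Proof.
move=> fNoo [+ umin]; rewrite /edom /tilt /= => fu.
have {}fu : f u \is a fin_num.
  by rewrite fin_numE fNoo/=; apply/eqP => fuoo; rewrite fuoo in fu.
split; first by rewrite /edom /= ltey_eq fu.
move=> z; have := umin z; rewrite /tilt.
have -> : (y (z - x0) = y (u - x0) + y (z - u))%R.
  by rewrite -linearD [in RHS]addrC addrA subrK.
have -> : ((y + xi)%R (z - u) = y (z - u) + xi (z - u))%R by [].
rewrite leeBrDr// -[f u]fineK// -!EFinD; apply: le_trans.
by rewrite lee_fin; lra.
Qed.

End affine_perturbation.

(** * The two implications, with constants *)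

Section quadratic_growth_subregularity.
Context {R : realType}.
Local Open Scope ereal_scope.

Lemma subdifferential_fin_num {X : normedModType R} (f : X -> \bar R) x y :
  (forall x, f x != -oo) -> subdifferential f x y -> f x \is a fin_num.
Proof.
by move=> fNoo [+ _]; rewrite /edom /= fin_numE fNoo ltey.
Qed.

Lemma quadratic_growth_tilt {X : normedModType R} (f : X -> \bar R) x0 y c :
  f x0 \is a fin_num ->
  (exists2 U, nbhs x0 U &
    forall x, U x -> (c * `|x - x0| ^+ 2)%:E <= tilt f y x0 x) ->
  quadratic_growth f x0 y c.
Proof.
move=> fx0 [U x0U fU]; exists U => // x /fU.
by rewrite /tilt leeBrDr// EFinD fineK// [X in X <= _ -> _]addeC.
Qed.

Lemma strongly_subregular_quadratic_growth {X : completeNormedModType R}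
    (f : X -> \bar R) (xb : X) (yb : topdual X) (kappa c : R) :
  Gamma f -> subdifferential f xb yb ->
  strongly_subregular_with (subdifferential f) xb yb kappa ->
  (c < 1 / (4 * kappa))%R -> quadratic_growth f xb yb c.
Proof.
move=> [fNoo _ lf cf] hyb [_ kappa0 [U [V [xU yV sub]]]] ck.
have fxb := subdifferential_fin_num fNoo hyb.
apply: quadratic_growth_tilt => //.
set g := tilt f yb xb.
have g0 x : 0 <= g x.
  by rewrite leeBrDr// add0e EFinD fineK//; exact: hyb.2.
have [c0|c0] := leP c 0%R.
  exists setT => [|x _]; first exact: filterT.
  by apply: le_trans (g0 x); rewrite lee_fin mulr_le0_ge0// exprn_ge0.
have {}ck : (4 * (kappa * c) < 1)%R.
  by move: ck; rewrite ltr_pdivlMr ?mulr_gt0//; lra.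
move/nbhs_ballP: xU => [d /= d0 dU]; move/nbhs_ballP: yV => [e /= e0 eV].
have d20 : (0 < d / 2)%R by exact: divr_gt0.
have ec0 : (0 < e / (2 * c))%R by rewrite divr_gt0// mulr_gt0.
(* The first radius puts [u] in [U], since [|u - xb| < 3 r / 2 < d]; the second gives
   [|xi| <= 2 c r < e], which puts [yb + xi] in [V]. *)
exists (ball xb (d / 2) `&` ball xb (e / (2 * c)))%classic.
  by apply: filterI; exact: nbhsx_ballx.
move=> x; rewrite -!ball_normE /ball_ /= distrC; set r := `|x - xb|%R.
rewrite ltr_pdivlMr// ltr_pdivlMr ?mulr_gt0// => -[rd re].
rewrite leNgt; apply/negP => gx.
have r0 : (0 < r)%R.
  rewrite lt_neqAle normr_ge0 andbT; apply/eqP => r0.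
  by move: gx; rewrite -r0 expr0n/= mulr0 ltNge g0.
have eta0 : (0 < 2 * c * r)%R by rewrite !mulr_gt0.
have gfin : g x \is a fin_num.
  by rewrite ge0_fin_numE// (lt_trans gx)// ltry.
have [u gux umin] :=
  ekeland (@tilt_lower_semicontinuous _ _ f yb xb lf) g0 gfin eta0.
have xu : (`|x - u| < r / 2)%R.
  have : (2 * c * r * `|x - u|)%:E < (c * r ^+ 2)%:E.
    by apply: le_lt_trans gx; apply: le_trans gux; rewrite leeDr.
  by rewrite lte_fin expr2 => h; rewrite -(ltr_pM2l (mulr_gt0 c0 r0)); lra.
have gu : g u \is a fin_num.
  rewrite ge0_fin_numE//; apply: le_lt_trans (lt_trans gx (ltry _)).
  by apply: le_trans gux; rewrite leeDl// lee_fin mulr_ge0// ltW.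
have gNoo z : g z != -oo by rewrite gt_eqF// (lt_le_trans _ (g0 z)).
have [xi xir xiu] := subdifferential_perturbed_min gNoo
  (@tilt_econvex _ _ f yb xb cf) gu (ltW eta0) umin.
have fu := subdifferential_tilt fNoo xiu.
have yxi : `|yb - (yb + xi)|%R = `|xi|%R by rewrite opprD addNKr normrN.
have Vu : V (yb + xi)%R.
  by apply: eV; rewrite -ball_normE /ball_ /= yxi (le_lt_trans xir)//; lra.
have ru : (`|u - xb| <= kappa * (2 * c * r))%R.
  rewrite -lee_fin; apply: (@le_trans _ _
    (kappa%:E * dist yb (subdifferential f u `&` V)%classic)).
    apply: sub; apply: dU; rewrite -ball_normE /ball_ /=.
    have := ler_distD x xb u; rewrite [`|xb - x|%R]distrC -/r; lra.
  rewrite EFinM lee_wpmul2l//; first by rewrite lee_fin ltW.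
  apply: ge_ereal_inf; exists `|yb - (yb + xi)|%:E; last by rewrite yxi lee_fin.
  by exists (yb + xi)%R.
(* Here [r <= |x - u| + |u - xb| < r / 2 + 2 kappa c r], while [4 kappa c < 1] makes the right side
   less than [r]. *)
have := ler_distD u x xb; rewrite -/r.
have : (4 * (kappa * c) * r < 1 * r)%R by rewrite ltr_pM2r.
lra.
Qed.

Lemma quadratic_growth_strongly_subregular {X : normedModType R}
    (f : X -> \bar R) (xb : X) (yb : topdual X) (c : R) :
  (forall x, f x != -oo) -> subdifferential f xb yb -> (0 < c)%R ->
  quadratic_growth f xb yb c ->
  strongly_subregular_with (subdifferential f) xb yb (1 / c).
Proof.
move=> fNoo hyb c0 [U xU fU]; split=> //; first exact: divr_gt0.
(* The bound [c |x - xb| <= |yb - y|] holds for every subgradient [y] at [x], however far from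
   [yb]. *)
exists U, setT; split=> // [|x Ux]; first exact: filterT.
rewrite div1r lee_pdivlMl//; apply: le_ereal_inf_tmp => _ [y [fxy _] <-].
rewrite -EFinM lee_fin.
have [->|x0] := eqVneq x xb; first by rewrite subrr normr0 mulr0.
have nx0 : (0 < `|x - xb|)%R by rewrite normr_gt0 subr_eq0.
have fx := subdifferential_fin_num fNoo fxy.
have fxb := subdifferential_fin_num fNoo hyb.
have := fxy.2 xb; have := fU x Ux.
rewrite -[f x]fineK// -[f xb]fineK// -!EFinD !lee_fin.
have -> : (y (xb - x) = - y (x - xb))%R by rewrite -linearN opprB.
have := topdual_norm_bound (yb - y)%R (x - xb)%R.
have -> : ((yb - y)%R (x - xb)%R = yb (x - xb) - y (x - xb))%R by [].
rewrite -[topdual_norm _]/(`|yb - y|%R).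
rewrite ler_norml => /andP[+ _]; rewrite expr2 => *; rewrite -(ler_pM2r nx0); lra.
Qed.

End quadratic_growth_subregularity.

Theorem theorem3p1 (R : realType) (X : completeNormedModType R)
    (f : X -> \bar R) (hf : Gamma f) (xb : X) (yb : topdual X)
    (hyb : subdifferential f xb yb) :
  [/\ strongly_subregular (subdifferential f) xb yb <->
        (exists c : R, 0 < c /\ quadratic_growth f xb yb c),
      forall kappa : R, 0 < kappa ->
        strongly_subregular_with (subdifferential f) xb yb kappa ->
        forall c : R, c < 1 / (4 * kappa) -> quadratic_growth f xb yb c
    & forall c : R, 0 < c -> quadratic_growth f xb yb c ->
        strongly_subregular_with (subdifferential f) xb yb (1 / c)].
Proof.
have fNoo : forall x, f x != -oo%E by case: hf.
have growth kappa c :=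
  @strongly_subregular_quadratic_growth _ _ _ _ _ kappa c hf hyb.
have subreg c :=
  @quadratic_growth_strongly_subregular _ _ _ _ _ c fNoo hyb.
split; [split| |exact: subreg].
- move=> [kappa sk]; have [_ kappa0 _] := sk.
  (* Any positive constant below [1 / (4 * kappa)] would serve. *)
  exists (1 / (8 * kappa)); split; first by rewrite divr_gt0// mulr_gt0.
  apply: growth sk _; rewrite !div1r ltf_pV2 ?posrE ?mulr_gt0//.
  by rewrite ltr_pM2r// ltr_nat.
- by move=> [c [c0 fc]]; exists (1 / c); exact: subreg.
- by move=> kappa _ sk c; exact: growth.
Qed.
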